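(* Let $E=\mathbb{Q}(\sqrt{-3})$ and let $\mathfrak{O}=\mathbb{Z}\left[\frac{1+\sqrt{-3}}{2}\right]$ be its ring of integers. The ternary Hermitian $\mathfrak{O}$-lattices $\langle 1,1,1\rangle$ and $\langle 1,1,2\rangle$ are both $2$-universal.
   Context: A Hermitian $\mathfrak{O}$-lattice is a finitely generated $\mathfrak{O}$-submodule $L$ of a finite-dimensional $E$-vector space equipped with a form $H$ that is linear in the first variable, satisfies $H(x,y)=\overline{H(y,x)}$ (bar is complex conjugation), and has $H(L,L)\subseteq\mathfrak{O}$. Its rank is $\dim_E EL$; binary means rank 2, ternary means rank 3. It is positive (definite) if $H(v):=H(v,v)>0$ for all $0\neq v\in L$. Here every lattice is free ($\mathfrak{O}$ is a PID); the Gram matrix of a lattice with basis $v_1,\dots,v_n$ is $M_L=(H(v_i,v_j))$. $\langle a_1,\dots,a_n\rangle$ denotes the free lattice with diagonal Gram matrix with entries $a_1,\dots,a_n$. $L$ represents $\ell$ if $M_\ell=XM_LX^*$ for some matrix $X$ over $\mathfrak{O}$, where $X^*$ is the conjugate transpose. A positive Hermitian $\mathfrak{O}$-lattice is $2$-universal if it represents all binary positive Hermitian $\mathfrak{O}$-lattices. *)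

(* Defs.v *)
From HB Require Import structures.
From mathcomp Require Import all_boot all_order all_algebra all_field ring lra.

Set Implicit Arguments.
Unset Strict Implicit.
Unset Printing Implicit Defensive.

Import Order.TTheory GRing.Theory Num.Theory.
Local Open Scope ring_scope.

Definition sqrtm3 : algC := sqrtC (- 3%:R).
Definition omega : algC := (1 + sqrtm3) / 2%:R.

Definition Qsqrtm3 : {pred algC} := Crat_span [:: 1; sqrtm3].
(* Additive span, which is the whole ring Z[omega] as omega ^+ 2 = omega - 1. *)
Definition Zomega : {pred algC} := Cint_span [:: 1; omega].

Lemma sqrtm3_sqr : sqrtm3 * sqrtm3 = - 3%:R.
Proof. by rewrite -expr2 sqrtCK. Qed.

Lemma omega_sqr : omega * omega = omega - 1.
Proof. by have := sqrtm3_sqr; rewrite /omega => h; field: h. Qed.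

Lemma Qsqrtm3P x :
  reflect (exists a b : rat, x = ratr a + ratr b * sqrtm3) (x \in Qsqrtm3).
Proof.
apply: (iffP (Crat_spanP _ _)) => [[a ->]|[a [b ->]]].
  exists (a ord0), (a (lift ord0 ord0)).
  by rewrite big_ord_recl big_ord1 /= mulr1.
exists [ffun i => if val i == 0%N then a else b].
by rewrite big_ord_recl big_ord1 /= !ffunE /= mulr1.
Qed.

Lemma ZomegaP x :
  reflect (exists a b : int, x = a%:~R + b%:~R * omega) (x \in Zomega).
Proof.
apply: (iffP (Cint_spanP [tuple 1; omega] _)) => [[a ->]|[a [b ->]]].
  exists (a ord0), (a (lift ord0 ord0)).
  by rewrite big_ord_recl big_ord1 /= mulrzl.
exists [ffun i => if val i == 0%N then a else b].
by rewrite big_ord_recl big_ord1 /= !ffunE /= mulrzl.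
Qed.

Fact Qsqrtm3_divring_closed : divring_closed Qsqrtm3.
Proof.
have mulE : {in Qsqrtm3 &, forall x y, x * y \in Qsqrtm3}.
  move=> _ _ /Qsqrtm3P[a [b ->]] /Qsqrtm3P[c [d ->]]; apply/Qsqrtm3P.
  exists (a * c - 3%:R * (b * d)), (a * d + b * c).
  rewrite rmorphB rmorphD !rmorphM rmorph_nat /=.
  by ring: sqrtm3_sqr.
split=> [|_ _ /Qsqrtm3P[a [b ->]] /Qsqrtm3P[c [d ->]]|x y Ex Ey].
- by rewrite mem_Crat_span ?inE ?eqxx.
- apply/Qsqrtm3P; exists (a - c), (b - d); rewrite !rmorphB /=; ring.
apply: mulE => //; have /Qsqrtm3P[a [b Dy]] := Ey.
have [->|y0] := eqVneq y 0; first by rewrite invr0 rpred0.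
pose N := a * a + 3%:R * (b * b).
have N0 : N != 0.
  apply: contraNneq y0 => N0; have [a0 b0] : a = 0 /\ b = 0.
    by rewrite /N in N0; split; nra.
  by rewrite Dy a0 b0 rmorph0 mul0r addr0.
have NE : ratr N = y * (ratr a - ratr b * sqrtm3) :> algC.
  rewrite Dy rmorphD !rmorphM rmorph_nat /=; ring: sqrtm3_sqr.
apply/Qsqrtm3P; exists (a / N), (- (b / N)).
have rN0 : ratr N != 0 :> algC by rewrite fmorph_eq0.
rewrite rmorphN !fmorph_div /=; apply: (mulfI y0); rewrite divff //.
by apply: (mulfI rN0); rewrite mulr1 {1}NE; field.
Qed.

HB.instance Definition _ :=
  GRing.isDivringClosed.Build algC Qsqrtm3 Qsqrtm3_divring_closed.

Record Efield : predArgType := EField { Eval : algC; EvalP : Eval \in Qsqrtm3 }.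
HB.instance Definition _ := [isSub for Eval].
HB.instance Definition _ := [Choice of Efield by <:].
HB.instance Definition _ := [SubChoice_isSubIntegralDomain of Efield by <:].
HB.instance Definition _ := [SubIntegralDomain_isSubField of Efield by <:].

Definition Oring : {pred Efield} := [pred x | \val x \in Zomega].

Lemma conj_sqrtm3 : sqrtm3^* = - sqrtm3.
Proof.
have : (sqrtm3^* - sqrtm3) * (sqrtm3^* + sqrtm3) = 0.
  by rewrite mulrDr !mulrBl -rmorphM !sqrtm3_sqr /= rmorphN rmorph_nat; ring.
move/eqP; rewrite mulf_eq0 subr_eq0 addr_eq0 => /orP[/eqP/CrealP Rs|/eqP//].
have : 0 <= sqrtm3 ^+ 2 by rewrite real_exprn_even_ge0.
by rewrite expr2 sqrtm3_sqr oppr_ge0 lern0.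
Qed.

Fact Oring_subring_closed : subring_closed Oring.
Proof.
split=> [|x y|x y]; rewrite !inE.
- by apply/ZomegaP; exists 1, 0; rewrite mul0r addr0.
- by move=> Ox Oy; rewrite rmorphB rpredB.
move=> /ZomegaP[a [b Dx]] /ZomegaP[c [d Dy]]; apply/ZomegaP.
exists (a * c - b * d), (a * d + b * c + b * d).
by rewrite rmorphM /= Dx Dy !(rmorphD, rmorphB, rmorphM) /=; ring: omega_sqr.
Qed.

HB.instance Definition _ :=
  GRing.isSubringClosed.Build Efield Oring Oring_subring_closed.

Fact conj_Qsqrtm3 x : x \in Qsqrtm3 -> x^* \in Qsqrtm3.
Proof.
move=> /Qsqrtm3P[a [b ->]]; apply/Qsqrtm3P; exists a, (- b).
rewrite rmorphD (rmorphM _ (ratr b)) (fmorph_rat _ a) (fmorph_rat _ b) /=.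
by rewrite conj_sqrtm3 rmorphN mulrN mulNr.
Qed.

Definition bar (x : Efield) : Efield := EField (conj_Qsqrtm3 (EvalP x)).

Fact bar_is_zmod_morphism : zmod_morphism bar.
Proof. by move=> x y; apply: val_inj; rewrite /= !rmorphB. Qed.
Fact bar_is_monoid_morphism : monoid_morphism bar.
Proof.
by split=> [|x y]; apply: val_inj; rewrite /= ?(rmorph1, rmorphM).
Qed.
HB.instance Definition _ :=
  GRing.isZmodMorphism.Build Efield Efield bar bar_is_zmod_morphism.
HB.instance Definition _ :=
  GRing.isMonoidMorphism.Build Efield Efield bar bar_is_monoid_morphism.

Lemma barK : involutive bar.
Proof. by move=> x; apply: val_inj; rewrite /= conjCK. Qed.

Lemma bar_Oring x : x \in Oring -> bar x \in Oring.
Proof.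
rewrite !inE /= => /ZomegaP[a [b ->]]; apply/ZomegaP; exists (a + b), (- b).
rewrite rmorphD rmorphM /= !rmorph_int {1}/omega fmorph_div rmorphD rmorph1 /=.
by rewrite rmorph_nat conj_sqrtm3 rmorphD rmorphN /= /omega; field.
Qed.

Definition Ospan (V : vectType Efield) (s : seq V) (v : V) : Prop :=
  exists c : 'I_(size s) -> Efield,
    (forall i, c i \in Oring) /\ v = \sum_i c i *: s`_i.

(* The finitely generated submodule L of lat_space is given by a finite family
   of generators, not assumed independent; nothing below depends on the choice
   of this family beyond the submodule it generates. *)
Record hermitian_lattice := HermitianLattice {
  lat_space : vectType Efield;
  lat_form : {hermitian_sym lat_space for bar};
  lat_gens : seq lat_space;
  lat_integral : forall x y, Ospan lat_gens x -> Ospan lat_gens y ->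
    lat_form x y \in Oring
}.

Definition in_lat (L : hermitian_lattice) : lat_space L -> Prop :=
  Ospan (lat_gens L).

Definition lat_rank (L : hermitian_lattice) : nat := \dim <<lat_gens L>>%VS.

(* In algC, 0 < z means that z is a positive real number. *)
Definition positive_lattice (L : hermitian_lattice) : Prop :=
  forall v, in_lat v -> v != 0 -> 0 < \val (lat_form L v v).

(* A family of vectors is linearly independent over O iff it is so over E. *)
Definition is_lat_basis (L : hermitian_lattice) n (b : n.-tuple (lat_space L)) :=
  free b /\ (forall v, in_lat v <-> Ospan b v).

Definition gram (L : hermitian_lattice) n (b : n.-tuple (lat_space L)) :
  'M[Efield]_n := \matrix_(i, j) lat_form L (tnth b i) (tnth b j).

(* O is a principal ideal domain, so every lattice has a basis, and the
   condition does not depend on the bases chosen. *)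
Definition represents (L l : hermitian_lattice) : Prop :=
  exists n m (b : n.-tuple (lat_space L)) (b' : m.-tuple (lat_space l))
         (X : 'M[Efield]_(m, n)),
    [/\ is_lat_basis b, is_lat_basis b', X \is a mxOver Oring
      & gram b' = X *m gram b *m map_mx bar X^T].

Definition two_universal (L : hermitian_lattice) : Prop :=
  positive_lattice L /\
  forall l, lat_rank l = 2%N -> positive_lattice l -> represents L l.

Section DiagonalLattice.

Variable a : seq int.
Local Notation n := (size a).

Definition diag_gram : 'M[Efield]_n := diag_mx (\row_i (a`_i)%:~R).

Definition diag_form : 'rV[Efield]_n -> 'rV[Efield]_n -> Efield :=
  form bar diag_gram.

Fact diag_form_bilinear :
  bilinear_for (GRing.Scale.Law.clone _ _ *%R _)
    (GRing.Scale.Law.clone _ _ (bar \; *%R) _) diag_form.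
Proof.
split=> [u'|u] c x y; first by rewrite /diag_form formDl formZl.
by rewrite /diag_form formDr formZr.
Qed.

Fact diag_form_hermitian x y :
  diag_form x y = (-1) ^+ false * bar (diag_form y x).
Proof.
apply: (formC barK); apply/sesquiP; rewrite expr0 scale1r /diag_gram.
rewrite tr_diag_mx map_diag_mx; congr diag_mx.
by apply/rowP=> i; rewrite !mxE rmorph_int.
Qed.

HB.instance Definition _ := bilinear_isBilinear.Build
  Efield _ _ _ _ _ diag_form diag_form_bilinear.
HB.instance Definition _ := isHermitianSesquilinear.Build
  Efield _ _ _ diag_form diag_form_hermitian.

Definition diag_gens : seq 'rV[Efield]_n := [seq 'e_i | i : 'I_n].

Fact diag_integral x y :
  Ospan diag_gens x -> Ospan diag_gens y -> diag_form x y \in Oring.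
Proof.
have coordO z : Ospan diag_gens z -> z \is a mxOver Oring.
  move=> [c [Oc ->]]; apply: rpred_sum => i _; apply/mxOverP=> j k.
  rewrite mxE rpredM //.
  have /mapP[m _ ->] : diag_gens`_i \in diag_gens by rewrite mem_nth.
  by rewrite mxE rpred_nat.
move=> /coordO /mxOverP Ox /coordO /mxOverP Oy.
rewrite /diag_form /form mul_mx_diag mxE rpred_sum // => i _.
by rewrite !mxE !rpredM ?rpred_int // bar_Oring.
Qed.

(* Integer entries lose nothing: a diagonal Gram matrix has its entries in O and
   fixed by conjugation, that is, in Z. *)
Definition diag_lattice : hermitian_lattice :=
  HermitianLattice (lat_form := diag_form) diag_integral.

End DiagonalLattice.

(* Main.v *)
From HB Require Import structures.
Require Import Defs.
From mathcomp Require Import all_boot all_order all_algebra all_field.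
From mathcomp Require Import zify ring.

(** Let t be 1 or 2 and let M be the Gram matrix of a binary positive lattice,
    with diagonal a, c, off-diagonal entry b and determinant d = a c - N b.
    Up to enlarging the lattice of M, the matrix M is completed to a
    ternary Gram matrix of determinant t, and a ternary positive form of
    determinant 1 or 2 is diagonal in a suitable basis.

    Completion.  The matrix with rows (a, b, x), (b^*, c, y), (x^*, y^*, z) has
    determinant z d - Q(x, y), where Q is the adjugate form of M.  An integer z
    making it t exists exactly when Q(x, y) = - t modulo d, so everything depends on
    solving this congruence over the Eisenstein integers.  Let p be a prime
    dividing d.  If p is not 3 then the norm takes all values modulo p
    (enorm_surj_mod), and the congruence is solvable modulo p unless p divides
    M, in which case the lattice of M lies in a larger integral lattice, hence
    one of smaller determinant (enlargeable_imprimitive).  The same enlargement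
    is possible when p^2 divides d (enlargeable_sq) or when p = 3
    (enlargeable3).  Therefore either M can be enlarged, and induction on d
    applies because representation is transitive, or d is squarefree with a
    solution modulo each of its prime factors; as Q is quadratic these
    solutions combine into one modulo d (global_solution).

    Reduction.  Lattice reduction in rank 3 with the covering constant 1/3 of
    the Eisenstein integers (eis_round) gives a basis whose first vector has
    norm a with 8 a^3 <= 27 t, so that a = 1 when t <= 2; the same estimates
    then force the form to be the diagonal one (gram3_diag).

    Passage to lattices.  Among the pairs of independent vectors of a lattice
    of rank 2, one with the smallest Gram determinant is a basis: otherwise
    rounding a coordinate of some lattice vector would produce a pair whose
    determinant is at most a third of it (lat_basis2).  This replaces any
    appeal to the structure of modules over a principal ideal domain. *)

Set Implicit Arguments.
Unset Strict Implicit.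
Unset Printing Implicit Defensive.

Import Order.TTheory GRing.Theory Num.Theory.
Local Open Scope ring_scope.

(** * The ring of Eisenstein integers *)

(** Pairs of integers standing for coord1 + coordw * omega.  Having them as a
    type of their own, instead of elements of the field E with a membership
    proof, turns every identity below into a polynomial identity over Z. *)
Record eis := Eis { coord1 : int; coordw : int }.

Definition eis_pair (x : eis) := (coord1 x, coordw x).
Definition pair_eis (x : int * int) := Eis x.1 x.2.
Fact eis_pairK : cancel eis_pair pair_eis. Proof. by case. Qed.
HB.instance Definition _ := Choice.copy eis (can_type eis_pairK).

Lemma eis_eqP x y : coord1 x = coord1 y -> coordw x = coordw y -> x = y.
Proof. by case: x y => [a b] [c d] /= -> ->. Qed.

Definition eis_add x y := Eis (coord1 x + coord1 y) (coordw x + coordw y).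
Definition eis_opp x := Eis (- coord1 x) (- coordw x).
Definition eis_mul x y :=
  Eis (coord1 x * coord1 y - coordw x * coordw y)
      (coord1 x * coordw y + coordw x * coord1 y + coordw x * coordw y).

Local Ltac eis_ax :=
  repeat case=> ? ?; apply: eis_eqP => /=; ring.
Fact eis_addA : associative eis_add. Proof. by eis_ax. Qed.
Fact eis_addC : commutative eis_add. Proof. by eis_ax. Qed.
Fact eis_add0 : left_id (Eis 0 0) eis_add. Proof. by eis_ax. Qed.
Fact eis_addN : left_inverse (Eis 0 0) eis_opp eis_add. Proof. by eis_ax. Qed.
HB.instance Definition _ :=
  GRing.isZmodule.Build eis eis_addA eis_addC eis_add0 eis_addN.
Fact eis_mulA : associative eis_mul. Proof. by eis_ax. Qed.
Fact eis_mulC : commutative eis_mul. Proof. by eis_ax. Qed.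
Fact eis_mul1 : left_id (Eis 1 0) eis_mul. Proof. by eis_ax. Qed.
Fact eis_mulD : left_distributive eis_mul eis_add. Proof. by eis_ax. Qed.
Fact eis_1neq0 : Eis 1 0 != 0. Proof. by []. Qed.
HB.instance Definition _ := GRing.Zmodule_isComNzRing.Build eis
  eis_mulA eis_mulC eis_mul1 eis_mulD eis_1neq0.

Definition econj x := Eis (coord1 x + coordw x) (- coordw x).
Fact econj_zmod : zmod_morphism econj.
Proof. by repeat case=> ? ?; apply: eis_eqP => /=; ring. Qed.
Fact econj_monoid : monoid_morphism econj.
Proof. by split=> //; repeat case=> ? ?; apply: eis_eqP => /=; ring. Qed.
HB.instance Definition _ := GRing.isZmodMorphism.Build eis eis econj econj_zmod.
HB.instance Definition _ :=
  GRing.isMonoidMorphism.Build eis eis econj econj_monoid.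

Definition enorm x : int := coord1 x ^+ 2 + coord1 x * coordw x + coordw x ^+ 2.
Definition etrace x : int := coord1 x + coord1 x + coordw x.

Lemma mul_econj x : x * econj x = Eis (enorm x) 0.
Proof. by case: x => ? ?; apply: eis_eqP; rewrite /enorm /=; ring. Qed.
Lemma enorm_econj x : enorm (econj x) = enorm x.
Proof. by case: x => ? ?; rewrite /enorm /=; ring. Qed.
Lemma enormM x y : enorm (x * y) = enorm x * enorm y.
Proof. by case: x y => ? ? [? ?]; rewrite /enorm /=; ring. Qed.
Lemma enorm_ge0 x : 0 <= enorm x.
Proof. case: x => u v; rewrite /enorm /=; nia. Qed.
Lemma enorm_eq0 x : enorm x = 0 -> x = 0.
Proof. case: x => u v; rewrite /enorm /= => h; apply: eis_eqP => /=; nia. Qed.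

Lemma int_round (u d : int) : 0 < d -> exists k, - d <= 2 * (u - k * d) <= d.
Proof.
move=> d0; have := divz_eq u d; have := modz_ge0 u (lt0r_neq0 d0).
have := ltz_pmod u d0; move: (divz u d) (modz u d) => k r r1 r0 e.
by have [h|h] := leP (2 * r) d; [exists k|exists (k + 1)]; lia.
Qed.

(** Rounding both coordinates leaves a point of a parallelogram, larger than the
    Voronoi hexagon of the lattice: one more step to a neighbour is needed near
    its two acute corners to get down to the covering radius. *)
Lemma hex_round_pos (s r d : int) : 0 <= 2 * s <= d -> 0 <= 2 * r <= d ->
  exists i j, 3 * enorm (Eis (s - i * d) (r - j * d)) <= d ^+ 2.
Proof.
rewrite /enorm /=.
wlog le_rs : s r / r <= s.
  move=> IH hs hr; have [|/ltW] := leP r s; first by move=> h; apply: IH.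
  by move=> /IH - /(_ hr hs) [i [j h]]; exists j, i; move: h; lia.
move=> /andP[s0 s1] /andP[r0 r1]; have [h|h] := leP (2 * s + r) d.
  (* With X = 2 s + r and Y = s + 2 r, the norm is (X^2 - X Y + Y^2) / 3. *)
  exists 0, 0; have h2 : 0 <= (d - 2 * s - r) * (2 * s + r + d) by nia.
  have h3 : 0 <= (s - r) * (s + 2 * r) by nia.
  have h4 : 0 <= s * r by nia.
  nia.
exists 1, 0.
have h1 : 0 <= (s - r) * (2 * s + r - d) by nia.
have h2 : 0 <= (d - 2 * s) * (3 * s - d) by nia.
have h3 : 0 <= (2 * s + r - d) * (d - 2 * s) by nia.
have h4 : 0 <= (2 * s + r - d) * r by nia.
have h5 : 0 <= (s - r) * (d - 2 * s) by nia.
nia.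
Qed.

Lemma hex_round (s r d : int) : - d <= 2 * s <= d -> - d <= 2 * r <= d ->
  exists i j, 3 * enorm (Eis (s - i * d) (r - j * d)) <= d ^+ 2.
Proof.
wlog s0 : s r / 0 <= s.
  move=> IH hs hr; have [|/ltW s0] := leP 0 s; first by move=> h; apply: IH.
  have [|||i [j h]] := IH (- s) (- r); try lia.
  by exists (- i), (- j); move: h; rewrite /enorm /=; lia.
move=> hs hr; have [r0|/ltW r0] := leP 0 r; first by apply: hex_round_pos; lia.
exists 0, 0; rewrite /enorm /=.
have : 0 <= s * - r by nia.
have : 0 <= (d - 2 * s) * (d + 2 * s) by nia.
have : 0 <= (d - 2 * r) * (d + 2 * r) by nia.
have : 0 <= (d - 2 * s) * (d + 2 * r) by nia.
nia.
Qed.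

(** The constant 1/3 is the covering constant of the hexagonal lattice, and it
    matters: rounding each coordinate separately gives 3/4, and even 7/16
    would be too weak for the reduction in determinant 2. *)
Lemma eis_round x (d : int) : 0 < d ->
  exists q, 3 * enorm (x - q * Eis d 0) <= d ^+ 2.
Proof.
case: x => u v d0; have [k hk] := int_round u d0; have [l hl] := int_round v d0.
have [i [j h]] := hex_round hk hl.
exists (Eis (k + i) (l + j)); apply: le_trans h.
by rewrite /enorm /=; lia.
Qed.

(** * Representations between Gram matrices *)

Definition adjmx m n (X : 'M[eis]_(m, n)) := map_mx econj X^T.
(** The lattice of G contains vectors, the rows of X, with Gram matrix G'. *)
Definition gram_rep m n (G : 'M[eis]_n) (G' : 'M[eis]_m) :=
  exists X : 'M[eis]_(m, n), G' = X *m G *m adjmx X.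

Lemma gram_rep_trans m n k (A : 'M_m) (B : 'M_n) (C : 'M_k) :
  gram_rep A B -> gram_rep B C -> gram_rep A C.
Proof.
move=> [X ->] [Y ->]; exists (Y *m X).
by rewrite /adjmx trmx_mul map_mxM /= !mulmxA.
Qed.

Definition mx_of m n (s : seq (seq eis)) : 'M[eis]_(m, n) :=
  \matrix_(i, j) nth 0 (nth [::] s i) j.

Definition gram2 (a c : int) (b : eis) : 'M[eis]_2 :=
  mx_of 2 2 [:: [:: Eis a 0; b]; [:: econj b; Eis c 0]].
Definition gram3 (a c z : int) (b x y : eis) : 'M[eis]_3 :=
  mx_of 3 3 [:: [:: Eis a 0; b; x]; [:: econj b; Eis c 0; y];
                [:: econj x; econj y; Eis z 0]].

Local Ltac congruence_by_entries :=
  apply/matrixP; case=> [] [|[|[|//]]] // ? [] [|[|[|//]]] // ?;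
  rewrite /adjmx !(mxE, big_ord_recl, big_ord0) /=;
  apply: eis_eqP; rewrite /enorm /etrace /=; ring.

(** * Reduction of ternary forms of determinant 1 and 2 *)

(** The moves of the reduction: adding to a basis vector a multiple of the
    previous one, and exchanging neighbours.  Here a, c, z are the norms of the
    basis vectors, and b, x, y the products (1,2), (1,3), (2,3). *)
Lemma gram3_shift12 a c z b x y q :
  gram_rep (gram3 a (c - etrace (econj q * b) + a * enorm q) z
         (b - q * Eis a 0) x (y - econj q * x))
      (gram3 a c z b x y).
Proof.
exists (mx_of 3 3 [:: [:: 1; 0; 0]; [:: econj q; 1; 0]; [:: 0; 0; 1]]).
by case: b x y q => [? ?] [? ?] [? ?] [? ?]; congruence_by_entries.
Qed.

Lemma gram3_shift23 a c z b x y q :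
  gram_rep (gram3 a c (z - etrace (econj q * y) + c * enorm q)
         b (x - q * b) (y - q * Eis c 0))
      (gram3 a c z b x y).
Proof.
exists (mx_of 3 3 [:: [:: 1; 0; 0]; [:: 0; 1; 0]; [:: 0; econj q; 1]]).
by case: b x y q => [? ?] [? ?] [? ?] [? ?]; congruence_by_entries.
Qed.

Lemma gram3_swap12 a c z b x y :
  gram_rep (gram3 c a z (econj b) y x) (gram3 a c z b x y).
Proof.
exists (mx_of 3 3 [:: [:: 0; 1; 0]; [:: 1; 0; 0]; [:: 0; 0; 1]]).
by case: b x y => [? ?] [? ?] [? ?]; congruence_by_entries.
Qed.

Lemma gram3_swap23 a c z b x y :
  gram_rep (gram3 a z c x b (econj y)) (gram3 a c z b x y).
Proof.
exists (mx_of 3 3 [:: [:: 1; 0; 0]; [:: 0; 0; 1]; [:: 0; 1; 0]]).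
by case: b x y => [? ?] [? ?] [? ?]; congruence_by_entries.
Qed.

Lemma gram3_split t x :
  gram_rep (gram3 1 1 t 0 0 0) (gram3 1 1 (t + enorm x) 0 x 0).
Proof.
exists (mx_of 3 3 [:: [:: 1; 0; 0]; [:: 0; 1; 0]; [:: econj x; 0; 1]]).
by case: x => [? ?]; congruence_by_entries.
Qed.

Definition det2 (a c : int) (b : eis) : int := a * c - enorm b.
Definition det3 (a c z : int) (b x y : eis) : int :=
  z * det2 a c b - (a * enorm y + c * enorm x - etrace (b * econj x * y)).

(** Jacobi's identity: the right-hand side is the determinant of a times the
    form induced on the complement of the first basis vector, whose diagonal
    entries are the two minors and whose off-diagonal entry is inside enorm. *)
Lemma det3_jacobi a c z b x y :
  a * det3 a c z b x y =
  det2 a c b * det2 a z x - enorm (y * Eis a 0 - econj b * x).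
Proof.
case: b x y => [? ?] [? ?] [? ?]; rewrite /det3 /det2 /enorm /etrace /=; ring.
Qed.

(** For t > 0 this is Sylvester's criterion. *)
Definition posdef3 t a c z b x y :=
  [/\ 0 < a, 0 < det2 a c b & det3 a c z b x y = t].

Lemma gram3_reduce12 t a c z b x y : posdef3 t a c z b x y ->
  exists c' b' y', [/\ gram_rep (gram3 a c' z b' x y') (gram3 a c z b x y),
    posdef3 t a c' z b' x y', det2 a c' b' = det2 a c b
    & 3 * enorm b' <= a ^+ 2].
Proof.
case=> a0 d0 dt; have [q hq] := eis_round b a0.
eexists; eexists; eexists.
split; [exact: (gram3_shift12 _ _ _ _ _ _ q)| | |exact: hq].
  split => //; [move: d0|rewrite -dt].
    suff -> : det2 a (c - etrace (econj q * b) + a * enorm q) (b - q * Eis a 0)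
      = det2 a c b by [].
    case: b {dt hq} q => [? ?] [? ?]; rewrite /det2 /enorm /etrace /=; ring.
  case: b x y {d0 dt hq} q => [? ?] [? ?] [? ?] [? ?].
  rewrite /det3 /det2 /enorm /etrace /=; ring.
case: b {d0 dt hq} q => [? ?] [? ?]; rewrite /det2 /enorm /etrace /=; ring.
Qed.

Lemma gram3_reduce23 t a c z b x y : posdef3 t a c z b x y ->
  exists z' x' y', [/\ gram_rep (gram3 a c z' b x' y') (gram3 a c z b x y),
    posdef3 t a c z' b x' y' &
    3 * enorm (y' * Eis a 0 - econj b * x') <= det2 a c b ^+ 2].
Proof.
case=> a0 d0 dt; have [q hq] := eis_round (y * Eis a 0 - econj b * x) d0.
eexists; eexists; eexists; split; first exact: (gram3_shift23 _ _ _ _ _ _ q).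
  split => //; rewrite -dt.
  case: b x y {d0 dt hq} q => [? ?] [? ?] [? ?] [? ?].
  rewrite /det3 /det2 /enorm /etrace /=; ring.
move: hq; congr (3 * enorm _ <= _); move: (mul_econj b).
case: b x y {d0 dt} q => [? ?] [? ?] [? ?] [? ?] _.
by apply: eis_eqP; rewrite /det2 /enorm /=; ring.
Qed.

(** The induction is lexicographic on a and the leading 2x2 minor D.  After size
    reduction, an exchange decreases a or keeps a and decreases D, unless
    3 D >= 2 a^2 and 3 a t >= 2 D^2; as t <= 2 these give 4 a^4 <= 27 a, whence
    a = 1 and D = 1, and the size-reduced entries vanish. *)
Lemma gram3_diag (t : int) a c z b x y : 0 < t <= 2 -> posdef3 t a c z b x y ->
  gram_rep (gram3 1 1 t 0 0 0) (gram3 a c z b x y).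
Proof.
move=> t2.
have [A] : exists A : nat, a < A%:Z by exists (`|a|%N.+1); lia.
elim: A a c z b x y => [|A IHA] a c z b x y; first by move=> ? []; lia.
move=> aA.
have [D] : exists D : nat, det2 a c b < D%:Z.
  by exists (`|det2 a c b|%N.+1); lia.
elim: D c z b x y => [|D IHD] c z b x y; first by move=> ? []; lia.
move=> dD /gram3_reduce12[c1 [b1 [y1 [h1 p1 e1 n1]]]].
apply: gram_rep_trans h1; move: p1 dD n1; rewrite -{}e1.
move: c1 b1 y1 => {c b y} c b y /gram3_reduce23[z1 [x1 [y1 [h1 p1 n1]]]] dD n.
apply: gram_rep_trans h1; move: z1 x1 y1 p1 n1 => {z x y} z x y p nP.
have [a0 d0 dt] := p.
have := enorm_ge0 b; have := enorm_ge0 x; have := det3_jacobi a c z b x y.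
have := enorm_ge0 (y * Eis a 0 - econj b * x); rewrite dt => P0 jac x0 b0.
have c0 : 0 < c by move: d0; rewrite /det2; nia.
have [ca|ac] := ltP c a.
  apply: gram_rep_trans (gram3_swap12 _ _ _ _ _ _); apply: IHA; first by lia.
  split=> //; first by move: d0; rewrite /det2 enorm_econj; lia.
  rewrite -dt; case: b x y {p n nP d0 jac x0 b0 dt P0 dD} => [? ?] [? ?] [? ?].
  rewrite /det3 /det2 /enorm /etrace /=; ring.
(* Exchanging the last two vectors replaces D by the minor on vectors 1, 3. *)
have [zd|dz] := ltP (det2 a z x) (det2 a c b).
  apply: gram_rep_trans (gram3_swap23 _ _ _ _ _ _); apply: IHD; first by lia.
  split=> //; first by nia.
  rewrite -dt.
  case: b x y {p n nP d0 jac x0 b0 dt P0 dD zd} => [? ?] [? ?] [? ?].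
  rewrite /det3 /det2 /enorm /etrace /=; ring.
have E1 : 2 * a ^+ 2 <= 3 * det2 a c b by rewrite /det2; nia.
have E2 : 2 * det2 a c b ^+ 2 <= 3 * (a * t).
  move: (det2 a c b) (det2 a z x) d0 dz nP jac P0 => d P d0 dP nP jac P0.
  have : 0 <= d * (P - d) by apply: mulr_ge0; lia.
  rewrite expr2 in nP *; lia.
have E3 : det2 a c b ^+ 2 <= 3 * a.
  have : a * t <= a * 2 by rewrite ler_pM2l //; lia.
  lia.
have a1 : a = 1.
  suff: a < 2 by lia.
  have [//|a2] := ltP a 2.
  have : 0 <= (3 * det2 a c b - 2 * a ^+ 2) * (3 * det2 a c b + 2 * a ^+ 2).
    by apply: mulr_ge0; nia.
  have -> : (3 * det2 a c b - 2 * a ^+ 2) * (3 * det2 a c b + 2 * a ^+ 2)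
    = 9 * det2 a c b ^+ 2 - 4 * (a * (a * (a * a))) by ring.
  have : 2 * 2 <= a * a by apply: ler_pM.
  have : a * (2 * 2 * 2) <= a * (a * (a * a)).
    by rewrite ler_pM2l // -mulrA ler_pM //; nia.
  nia.
subst a.
have d1 : det2 1 c b = 1.
  by move: d0 E3; rewrite mulr1 expr2; move: (det2 1 c b) => d; nia.
have bE : b = 0 by apply: enorm_eq0; nia.
subst b.
have cE : c = 1 by move: d1; rewrite /det2 /enorm /=; lia.
subst c.
have yE : y = 0.
  suff : y * Eis 1 0 - econj 0 * x = 0 by rewrite rmorph0 mul0r subr0 mulr1.
  apply: enorm_eq0; move: P0 nP.
  rewrite d1 expr1n; move: (enorm _); clear; lia.
subst y.
have -> : z = t + enorm x.
  by rewrite -dt /det3 /det2 mulr0 mul1r /enorm /etrace /=; lia.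
exact: gram3_split.
Qed.

(** * Norms modulo a prime *)

Lemma Euclid_dvdz (p : nat) (m n : int) : prime p ->
  (p %| m * n)%Z = (p %| m)%Z || (p %| n)%Z.
Proof. by move=> pp; rewrite !dvdzE abszM Euclid_dvdM. Qed.

Lemma prime_invz (p : nat) (c : int) : prime p -> ~~ (p %| c)%Z ->
  exists u, (p %| 1 - u * c)%Z.
Proof.
move=> pp pc; have : coprimez p c.
  by rewrite coprimezE prime_coprime // -dvdzE.
move=> /eqP cop; have [u [v]] := Bezoutz p c; rewrite cop => <-.
by exists v; rewrite addrK dvdz_mull.
Qed.

(** If the squares agree then p divides k - l or k + l, and k + l < p. *)
Lemma sqr_Fp_inj (p : nat) (k l : nat) : prime p -> (k <= p./2)%N ->
  (l <= p./2)%N -> odd p -> (k%:R ^+ 2 = l%:R ^+ 2 :> 'F_p) -> k = l.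
Proof.
move=> pp kh lh op /eqP; have p_gt := prime_gt1 pp.
rewrite -subr_eq0 subr_sqr mulf_eq0 -natrD -(dvdn_pcharf (pchar_Fp pp)).
case/orP => [|/dvdnP[[|m]]]; [|lia|].
  rewrite subr_eq0 => /eqP/(congr1 (@nat_of_ord _)).
  by rewrite !val_Fp_nat // !modn_small; lia.
nia.
Qed.

(** Pigeonhole: the values k^2 and the values n - 3 l^2 are each (p + 1) / 2 in
    number, so they cannot all be distinct among the p residues. *)
Lemma sum_sqr3_Fp (p : nat) (n : 'F_p) : prime p -> odd p -> p != 3%N ->
  exists k l : nat, k%:R ^+ 2 + 3 * l%:R ^+ 2 = n.
Proof.
move=> pp op p3; have p_gt := prime_gt1 pp.
have p3F : (3 : 'F_p) != 0.
  rewrite -(dvdn_pcharf (pchar_Fp pp)) gtnNdvd //; move: p_gt p3 op.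
  by case: p {pp n} => [|[|[|[|]]]].
pose f (x : 'I_(p./2).+1 + 'I_(p./2).+1) : 'F_p :=
  match x with
  | inl k => (k : nat)%:R ^+ 2
  | inr l => n - 3 * (l : nat)%:R ^+ 2
  end.
have [/existsP[[k l] /= /eqP kl]|no] :=
    boolP [exists kl : 'I_(p./2).+1 * 'I_(p./2).+1,
    (kl.1 : nat)%:R ^+ 2 == n - 3 * (kl.2 : nat)%:R ^+ 2].
  by exists k, l; rewrite kl subrK.
have /leq_card : injective f.
  have f_inj (k l : 'I_(p./2).+1) : (k%:R ^+ 2 = l%:R ^+ 2 :> 'F_p) -> k = l.
    move=> kl; apply/val_inj/(sqr_Fp_inj pp _ _ op kl);
    by rewrite -ltnS ltn_ord.
  move=> [k|k] [l|l] /= e.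
  - by congr inl; apply: f_inj.
  - by case/negP: no; apply/existsP; exists (k, l); rewrite /= e.
  - by case/negP: no; apply/existsP; exists (l, k); rewrite /= e.
  - congr inr; apply/f_inj/(mulfI p3F)/oppr_inj.
    exact: (addrI n e).
rewrite card_Fp // card_sum !card_ord => le; lia.
Qed.

(** For odd p this follows from 4 (u^2 + u v + v^2) = (2 u + v)^2 + 3 v^2.  It
    fails for p = 3, modulo which the norm of u + v omega is (u - v)^2. *)
Lemma enorm_surj_mod (p : nat) (n : int) : prime p -> p != 3%N ->
  exists x, (p %| enorm x - n)%Z.
Proof.
move=> pp p3; have [op|] := boolP (odd p); last first.
  move=> /(prime_oddPn pp) ->.
  have [/eqP n2|n2] := boolP ((n %% 2%N)%Z == 0).
    exists 0; rewrite /enorm /=; lia.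
  exists 1; rewrite /enorm /=; lia.
have [k [l kl]] := sum_sqr3_Fp ((4 * n)%:~R) pp op p3.
have {}kl : (p %| k%:Z ^+ 2 + 3 * l%:Z ^+ 2 - 4 * n)%Z.
  rewrite (dvdz_pcharf (pchar_Fp pp)); apply/eqP.
  by rewrite -[RHS](subrr (4 * n)%:~R) -{1}kl; ring.
suff [u [v h]] : exists u v : int,
    (p %| (2 * u + v) ^+ 2 + 3 * v ^+ 2 - 4 * n)%Z.
  exists (Eis u v); have : (p %| 4 * (enorm (Eis u v) - n))%Z.
    by move: h; congr (_ %| _)%Z; rewrite /enorm /=; ring.
  rewrite Euclid_dvdz //; case/orP => //.
  rewrite dvdzE (Euclid_dvdX 2 2) // dvdn_prime2 // => /andP[/eqP /= p2].
  by move: op; rewrite p2.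
(* Solving 2 u + v = k, v = l needs k and l of the same parity; replacing k by
   k + p repairs the parity, as p is odd. *)
have [e|e] := boolP (odd k == odd l).
  exists ((k%:Z - l%:Z) %/ 2)%Z, l%:Z.
  suff -> : 2 * ((k%:Z - l%:Z) %/ 2)%Z + l%:Z = k%:Z by [].
  lia.
exists (((k + p)%N%:Z - l%:Z) %/ 2)%Z, l%:Z.
have -> : 2 * (((k + p)%N%:Z - l%:Z) %/ 2)%Z + l%:Z = (k + p)%N%:Z by lia.
have -> : (k + p)%N%:Z ^+ 2 + 3 * l%:Z ^+ 2 - 4 * n =
  (k%:Z ^+ 2 + 3 * l%:Z ^+ 2 - 4 * n) + (2 * k%:Z + p%:Z) * p%:Z by ring.
by rewrite rpredD // dvdz_mull.
Qed.

(** * Enlarging binary lattices *)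

Lemma gram2_shift a c b y :
  gram_rep (gram2 (a + etrace (b * econj y) + c * enorm y) c (b + y * Eis c 0))
      (gram2 a c b).
Proof.
exists (mx_of 2 2 [:: [:: 1; - y]; [:: 0; 1]]).
by case: b y => [? ?] [? ?]; congruence_by_entries.
Qed.

Lemma gram2_swap a c b : gram_rep (gram2 c a (econj b)) (gram2 a c b).
Proof.
exists (mx_of 2 2 [:: [:: 0; 1]; [:: 1; 0]]).
by case: b => [? ?]; congruence_by_entries.
Qed.

(** If the first basis vector e is such that H(e, e) is divisible by N w and
    H(e, f) by w, then e / w and f span a larger integral lattice. *)
Lemma gram2_div a c b w :
  gram_rep (gram2 a c b) (gram2 (a * enorm w) c (w * b)).
Proof.
exists (mx_of 2 2 [:: [:: w; 0]; [:: 0; 1]]).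
by case: b w => [? ?] [? ?]; congruence_by_entries.
Qed.

Lemma gram3_gram2 a c z b x y : gram_rep (gram3 a c z b x y) (gram2 a c b).
Proof.
exists (mx_of 2 3 [:: [:: 1; 0; 0]; [:: 0; 1; 0]]).
apply/matrixP; case=> [] [|[|//]] ? [] [|[|//]] ?;
by rewrite !(mxE, big_ord_recl, big_ord0) /=
   ?(mul0r, mulr0, mul1r, mulr1, add0r, addr0, rmorph0, rmorph1).
Qed.

Definition posdef2 a c b := 0 < c /\ 0 < det2 a c b.

Lemma det2_shift a c b y :
  det2 (a + etrace (b * econj y) + c * enorm y) c (b + y * Eis c 0) =
  det2 a c b.
Proof.
by case: b y => [? ?] [? ?]; rewrite /det2 /enorm /etrace /=; ring.
Qed.

Lemma det2_swap a c b : det2 c a (econj b) = det2 a c b.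
Proof. by rewrite /det2 enorm_econj mulrC. Qed.

Lemma posdef2_swap a c b : posdef2 a c b -> posdef2 c a (econj b).
Proof.
move=> [c0 d0]; split; rewrite ?det2_swap //.
by move: d0 (enorm_ge0 b); rewrite /det2; nia.
Qed.

Lemma posdef2_shift a c b y : posdef2 a c b ->
  posdef2 (a + etrace (b * econj y) + c * enorm y) c (b + y * Eis c 0).
Proof. by move=> [c0 d0]; split=> //; rewrite det2_shift. Qed.

(** This says that the lattice is properly contained in another integral one.
    All the enlargements below come from gram2_div, after a change of basis
    that creates the divisibility it requires. *)
Definition enlargeable a c b := exists a' c' b',
  [/\ gram_rep (gram2 a' c' b') (gram2 a c b), posdef2 a' c' b' &
      det2 a' c' b' < det2 a c b].

Lemma enlargeable_shift a c b y :
  enlargeable (a + etrace (b * econj y) + c * enorm y) c (b + y * Eis c 0) ->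
  enlargeable a c b.
Proof.
move=> [a' [c' [b' [h p d]]]]; exists a', c', b'; split=> //.
  exact: gram_rep_trans h (gram2_shift _ _ _ _).
by rewrite -(det2_shift a c b y).
Qed.

Lemma enlargeable_swap a c b : enlargeable c a (econj b) -> enlargeable a c b.
Proof.
move=> [a' [c' [b' [h p d]]]]; exists a', c', b'; split=> //.
  exact: gram_rep_trans h (gram2_swap _ _ _).
by rewrite -(det2_swap a c b).
Qed.

Lemma enlargeable_div a c b w :
  posdef2 (a * enorm w) c (w * b) -> 1 < enorm w ->
  enlargeable (a * enorm w) c (w * b).
Proof.
move=> [c0 d0] w1; exists a, c, b.
have E : det2 (a * enorm w) c (w * b) = enorm w * det2 a c b.
  by rewrite /det2 enormM; ring.
rewrite E in d0 *; split; first exact: gram2_div.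
  by split=> //; rewrite pmulr_rgt0 // in d0; lia.
rewrite pmulr_rgt0 in d0; last by lia.
by rewrite ltr_pMl.
Qed.

(** When c is invertible modulo w, replacing e by e - (b / c) f makes b
    divisible by w; then a is divisible by N w as soon as the determinant is. *)
Lemma enlargeable_complete_square a c b (u : int) (w w' : eis) :
  posdef2 a c b -> 1 < enorm w -> coprimez (enorm w) c ->
  (enorm w %| det2 a c b)%Z -> Eis (1 - u * c) 0 = w * w' ->
  enlargeable a c b.
Proof.
move=> p w1 cop dd wE.
apply: (@enlargeable_shift _ _ _ (- (b * Eis u 0))).
have := posdef2_shift (- (b * Eis u 0)) p.
have bE : b + - (b * Eis u 0) * Eis c 0 = w * (w' * b).
  rewrite mulrA -wE; case: (b) => ? ?; apply: eis_eqP; rewrite /=; ring.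
have := det2_shift a c b (- (b * Eis u 0)); rewrite bE.
move: (a + _ + _) => a' dE p'.
have /dvdzP[a1 aE] : (enorm w %| a')%Z.
  rewrite -(Gauss_dvdzl _ cop).
  have -> : a' * c = det2 a c b + enorm w * enorm (w' * b).
    by rewrite -dE /det2 (enormM w); ring.
  by rewrite rpredD // dvdz_mulr.
by rewrite aE in p' *; apply: enlargeable_div.
Qed.

(** The prime 3 is ramified: sqrt(-3) = 2 omega - 1 has norm 3, so dividing a
    vector by it costs only one factor 3 of the determinant.  If 3 divides a
    then it divides the norm of b = u + v omega, which is (u - v)^2 modulo 3, so
    sqrt(-3) divides b. *)
Lemma enlargeable3 a c b : posdef2 a c b -> (3%N %| det2 a c b)%Z ->
  enlargeable a c b.
Proof.
have main a' c' b' : posdef2 a' c' b' -> (3%N %| det2 a' c' b')%Z ->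
    (3%N %| a')%Z -> enlargeable a' c' b'.
  move=> p /dvdzP[k dk] /dvdzP[a1 aE].
  have [x xE] : exists x, b' = Eis (-1) 2 * x.
    case: b' dk {p} => u v; rewrite aE /det2 /enorm /= => dk.
    have [m mE] : exists m, u - v = 3 * m.
      have : (3%N %| (u - v) * (u - v))%Z.
        apply/dvdzP; exists (a1 * c' - k - u * v); lia.
      by rewrite Euclid_dvdz // orbb => /dvdzP[m ->]; exists m; ring.
    have -> : u = v + 3 * m by lia.
    exists (Eis (m + v) (- 2 * m - v)); apply: eis_eqP => /=; ring.
  have N3 : enorm (Eis (-1) 2) = 3 by [].
  have -> : a' = a1 * enorm (Eis (-1) 2) by rewrite N3 aE.
  by move: p; rewrite aE -[X in a1 * X]N3 xE => p; apply: enlargeable_div.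
move=> p d3; have [ac|ac] := boolP (3%N %| a)%Z; first exact: main.
have [cc|cc] := boolP (3%N %| c)%Z.
  by apply/enlargeable_swap/main; rewrite ?det2_swap //; apply: posdef2_swap.
have [u /dvdzP[q uq]] := prime_invz (isT : prime 3) cc.
apply: (@enlargeable_complete_square _ _ _ u (Eis (-1) 2)
  (Eis q 0 * Eis 1 (-2))) => //.
  have -> : enorm (Eis (-1) 2) = 3%N by [].
  by rewrite coprimezE prime_coprime // -dvdzE.
by rewrite uq; apply: eis_eqP => /=; ring.
Qed.

(** The trace pairing of b and y has determinant 3 on the basis 1, omega, and
    this is invertible modulo p. *)
Lemma etrace_nondeg (p : nat) b : prime p -> p != 3%N ->
  ~~ ((p %| coord1 b)%Z && (p %| coordw b)%Z) ->
  exists y, ~~ (p %| etrace (b * econj y))%Z.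
Proof.
move=> pp p3 nb.
have [h1|h1] := boolP (p %| etrace (b * econj (Eis 1 0)))%Z;
  last by exists (Eis 1 0).
have [h2|h2] := boolP (p %| etrace (b * econj (Eis 0 1)))%Z;
  last by exists (Eis 0 1).
have p33 : (p %| Posz 3)%Z = false.
  by apply/negbTE; rewrite dvdzE /= dvdn_prime2.
case/negP: nb; apply/andP; split.
  have : (p %| Posz 3 * coord1 b)%Z.
    have -> : Posz 3 * coord1 b =
      2 * etrace (b * econj (Eis 1 0)) - etrace (b * econj (Eis 0 1)).
      by case: (b) => ? ?; rewrite /etrace /=; ring.
    by rewrite rpredB // dvdz_mull.
  by rewrite Euclid_dvdz // p33.
have : (p %| Posz 3 * coordw b)%Z.
  have -> : Posz 3 * coordw b =
    2 * etrace (b * econj (Eis 0 1)) - etrace (b * econj (Eis 1 0)).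
    by case: (b) => ? ?; rewrite /etrace /=; ring.
  by rewrite rpredB // dvdz_mull.
by rewrite Euclid_dvdz // p33.
Qed.

Lemma enlargeable_sq_coprime (p : nat) a c b : prime p -> posdef2 a c b ->
  (p%:Z * p%:Z %| det2 a c b)%Z -> ~~ (p %| c)%Z -> enlargeable a c b.
Proof.
move=> pp pos pd pc; have [u /dvdzP[q uq]] := prime_invz pp pc.
have Np : enorm (Eis p 0) = p%:Z * p%:Z by rewrite /enorm /=; ring.
have p1 := prime_gt1 pp.
apply: (@enlargeable_complete_square _ _ _ u (Eis p 0) (Eis q 0));
  rewrite ?Np //.
- by nia.
- by rewrite coprimezMl coprimezE prime_coprime // -dvdzE pc.
by rewrite uq; apply: eis_eqP => /=; ring.
Qed.

(** A form p M' has a vector e that is isotropic for M' modulo p, by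
    surjectivity of the norm: c M'(1, y) = N (c y + b) - (N b - a c).  Then
    e / p is integral against the whole lattice. *)
Lemma enlargeable_imprimitive (p : nat) (a c : int) (b : eis) :
  prime p -> p != 3%N -> posdef2 (a * p) (c * p) (b * Eis p 0) ->
  enlargeable (a * p) (c * p) (b * Eis p 0).
Proof.
move=> pp p3 pos; have p1 := prime_gt1 pp.
have Np : enorm (Eis p 0) = p%:Z * p%:Z by rewrite /enorm /=; ring.
have [/dvdzP[k cE]|pc] := boolP (p %| c)%Z.
  apply: enlargeable_swap; move: (posdef2_swap pos); rewrite cE.
  have -> : econj (b * Eis p 0) = Eis p 0 * econj b.
    by case: (b) => ? ?; apply: eis_eqP => /=; ring.
  have -> : k * p * p = k * enorm (Eis p 0) by rewrite Np; ring.
  by move=> pos'; apply: enlargeable_div => //; nia.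
have [u /dvdzP[q uq]] := prime_invz pp pc.
have [z zE] := enorm_surj_mod (enorm b - a * c) pp p3.
pose y := (z - b) * Eis u 0.
have /dvdzP[A AE] : (p %| a + etrace (b * econj y) + c * enorm y)%Z.
  suff : (p %| (a + etrace (b * econj y) + c * enorm y) * c)%Z.
    by rewrite Euclid_dvdz // (negbTE pc) orbF.
  have -> : (a + etrace (b * econj y) + c * enorm y) * c =
     enorm (b + y * Eis c 0) + a * c - enorm b.
    by case: (b) (y) => ? ? [? ?]; rewrite /enorm /etrace /=; ring.
  have -> : b + y * Eis c 0 = z + (b - z) * Eis (q * p) 0.
    by rewrite -uq /y; case: (b) (z) => ? ? [? ?]; apply: eis_eqP => /=; ring.
  have -> : enorm (z + (b - z) * Eis (q * p) 0) + a * c - enorm b =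
     (enorm z - (enorm b - a * c)) +
     (etrace (z * econj (b - z)) * q + enorm (b - z) * q * q * p) * p.
    by case: (b) (z) => ? ? [? ?]; rewrite /enorm /etrace /=; ring.
  by rewrite rpredD // dvdz_mull.
apply: (@enlargeable_shift _ _ _ y); have := posdef2_shift y pos.
have -> : a * p + etrace (b * Eis p 0 * econj y) + c * p * enorm y =
    A * enorm (Eis p 0).
  rewrite Np mulrA -AE; case: (b) (y) => ? ? [? ?].
  rewrite /enorm /etrace /=; ring.
have -> : b * Eis p 0 + y * Eis (c * p) 0 = Eis p 0 * (b + y * Eis c 0).
  case: (b) (y) => ? ? [? ?]; apply: eis_eqP => /=; ring.
by move=> pos'; apply: enlargeable_div => //; nia.
Qed.

Lemma eis_dvd (p : nat) b : (p %| coord1 b)%Z -> (p %| coordw b)%Z ->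
  exists b', b = b' * Eis p 0.
Proof.
move=> /dvdzP[u uE] /dvdzP[v vE]; exists (Eis u v).
by apply: eis_eqP; rewrite /= ?uE ?vE; ring.
Qed.

Lemma enlargeable_sq (p : nat) a c b : prime p -> p != 3%N -> posdef2 a c b ->
  (p%:Z * p%:Z %| det2 a c b)%Z -> enlargeable a c b.
Proof.
move=> pp p3 pos pd.
have [pc|] := boolP (p %| c)%Z; last exact: enlargeable_sq_coprime.
have swp a' c' b' : posdef2 a' c' b' -> (p%:Z * p%:Z %| det2 a' c' b')%Z ->
    ~~ (p %| a')%Z -> enlargeable a' c' b'.
  move=> pos' pd' pa'; apply/enlargeable_swap/(enlargeable_sq_coprime pp) => //.
    exact: posdef2_swap.
  by rewrite det2_swap.
have [pa|] := boolP (p %| a)%Z; last exact: swp.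
have [/andP[b1 b2]|nb] := boolP ((p %| coord1 b)%Z && (p %| coordw b)%Z).
  have [b' bE] := eis_dvd b1 b2.
  move: pa pc pos => /dvdzP[a' ->] /dvdzP[c' ->]; rewrite bE.
  exact: enlargeable_imprimitive.
have [y py] := etrace_nondeg pp p3 nb.
(* A shift making a nonzero modulo p: a and c vanish there, so its new value is
   the trace chosen above. *)
apply: (@enlargeable_shift _ _ _ y); apply: swp; rewrite ?det2_shift //.
  exact: posdef2_shift.
apply: contra py => h; rewrite -(rpredDr _ pa).
by rewrite -(rpredDr _ (dvdz_mulr (enorm y) pc)) [etrace _ + a]addrC.
Qed.

(** * Embedding binary lattices in ternary ones *)

(** The quadratic form of the adjugate matrix; see det3. *)
Definition adjform a c b x y :=
  a * enorm y + c * enorm x - etrace (b * econj x * y).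

(** If c or a is nonzero modulo p then the form represents every residue along
    a coordinate axis; if both vanish and b does not, then it is minus the trace
    of b x^* y, which takes every value already with x = 1. *)
Lemma local_solution (p : nat) (t a c : int) (b : eis) :
  prime p -> p != 3%N -> posdef2 a c b ->
  enlargeable a c b \/ exists x y, (p %| adjform a c b x y + t)%Z.
Proof.
move=> pp p3 pos.
have norm_solution e : ~~ (p %| e)%Z -> exists x, (p %| e * enorm x + t)%Z.
  move=> pe; have [u /dvdzP[q uq]] := prime_invz pp pe.
  have [x /dvdzP[k kE]] := enorm_surj_mod (- t * u) pp p3; exists x.
  apply/dvdzP; exists (e * k + t * q).
  have -> : enorm x = k * p - t * u by rewrite -kE; ring.
  have -> : (e * k + t * q) * p = e * k * p + t * (q * p) by ring.
  by rewrite -uq; ring.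
have [pc|/norm_solution[x h]] := boolP (p %| c)%Z; last first.
  right; exists x, 0; move: h; congr (_ %| _ + _)%Z.
  by case: (b) (x) => ? ? [? ?]; rewrite /adjform /enorm /etrace /=; ring.
have [pa|/norm_solution[x h]] := boolP (p %| a)%Z; last first.
  right; exists 0, x; move: h; congr (_ %| _ + _)%Z.
  by case: (b) (x) => ? ? [? ?]; rewrite /adjform /enorm /etrace /=; ring.
have [/andP[b1 b2]|nb] := boolP ((p %| coord1 b)%Z && (p %| coordw b)%Z).
  have [b' bE] := eis_dvd b1 b2; left.
  move: pa pc pos => /dvdzP[a' ->] /dvdzP[c' ->]; rewrite bE.
  exact: enlargeable_imprimitive.
right; have [y py] := etrace_nondeg pp p3 nb.
have [u /dvdzP[q uq]] := prime_invz pp py.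
exists 1, (econj y * Eis (t * u) 0).
have -> : adjform a c b 1 (econj y * Eis (t * u) 0) + t =
    a * enorm (econj y * Eis (t * u) 0) + c +
     t * (1 - u * etrace (b * econj y)).
  rewrite /adjform; case: (b) (y) => ? ? [? ?]; rewrite /enorm /etrace /=; ring.
apply: rpredD; last by rewrite uq mulrA dvdz_mull.
by apply: rpredD; rewrite // dvdz_mulr.
Qed.

Lemma adjform_comb a c b x1 y1 x2 y2 (r s : int) :
  adjform a c b (x1 * Eis r 0 + x2 * Eis s 0) (y1 * Eis r 0 + y2 * Eis s 0) =
  r * r * adjform a c b x1 y1 + s * s * adjform a c b x2 y2 +
  r * s * (adjform a c b (x1 + x2) (y1 + y2) - adjform a c b x1 y1
           - adjform a c b x2 y2).
Proof.
case: b x1 y1 x2 y2 => [? ?] [? ?] [? ?] [? ?] [? ?].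
rewrite /adjform /enorm /etrace /=; ring.
Qed.

(** Chinese remainder theorem for a quadratic form, on the prime factors of n.
    The alternative of an enlargement takes care of n not being squarefree. *)
Lemma global_solution (t a c : int) (b : eis) (n : nat) :
  posdef2 a c b -> (n %| det2 a c b)%Z ->
  enlargeable a c b \/ exists x y, (n %| adjform a c b x y + t)%Z.
Proof.
move=> pos; elim/ltn_ind: n => n IH nd.
have n0 : (0 < n)%N.
  by case: n nd {IH} => // /dvdzP[k]; case: pos; lia.
have [->|n1] := eqVneq n 1%N; first by right; exists 0, 0; rewrite dvd1z.
have pp : prime (pdiv n) by apply: pdiv_prime; lia.
have := pdiv_dvd n; move: (pdiv n) pp => p pp /dvdnP[m nE].
have p1 := prime_gt1 pp.
have pd : (p %| det2 a c b)%Z.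
  by apply: dvdz_trans nd; rewrite dvdzE nE /= dvdn_mull.
have [p3|p3] := eqVneq p 3%N; first by left; apply: enlargeable3; rewrite -?p3.
have [pm|pm] := boolP (p %| m)%N.
  left; apply: (enlargeable_sq pp p3 pos); apply: dvdz_trans nd.
  by rewrite nE PoszM dvdz_mul.
have [|[x1 [y1 h1]]] := local_solution t pp p3 pos; first by left.
have [|||[x2 [y2 h2]]] := IH m; [by nia| |by left|].
  by apply: dvdz_trans nd; rewrite dvdzE nE /= dvdn_mulr.
have cop : coprimez m p by rewrite coprimezE coprime_sym prime_coprime.
right; have [u [v]] := Bezoutz p m; rewrite gcdzC (eqP cop) => uv.
(* u p + v m = 1, so this vector is the first solution modulo p and the second
   modulo m. *)
exists (x1 * Eis (v * m) 0 + x2 * Eis (u * p) 0),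
       (y1 * Eis (v * m) 0 + y2 * Eis (u * p) 0).
rewrite adjform_comb nE PoszM Gauss_dvdz //.
move: (_ - _ - _) => B; move/dvdzP: h1 => [k1 h1]; move/dvdzP: h2 => [k2 h2].
have vm : v * m = 1 - u * p by rewrite -uv; ring.
have up : u * p = 1 - v * m by rewrite -uv; ring.
have -> : adjform a c b x1 y1 = k1 * p - t by rewrite -h1; ring.
have -> : adjform a c b x2 y2 = k2 * m - t by rewrite -h2; ring.
apply/andP; split.
  apply/dvdzP; exists (v * v * m * k1 * p + k2 * (u * p) * (u * p)
     + t * (2 * v - 2 * v * v * m) + v * (u * p) * B).
  rewrite up; ring.
apply/dvdzP; exists (u * u * p * k2 * m + k1 * (v * m) * (v * m)
     + t * (2 * u - 2 * u * u * p) + u * (v * m) * B).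
rewrite vm; ring.
Qed.

(** Either the lattice can be enlarged, which lowers the determinant, or it is a
    sublattice of a ternary one of determinant t. *)
Theorem binary_rep (t a c : int) (b : eis) : 0 < t <= 2 -> posdef2 a c b ->
  gram_rep (gram3 1 1 t 0 0 0) (gram2 a c b).
Proof.
move=> t2; have [D] : exists D : nat, det2 a c b < D%:Z.
  by exists (`|det2 a c b|%N.+1); lia.
elim: D a c b => [|D IH] a c b dD pos; first by case: pos; lia.
have [|[a' [c' [b' [h p d]]]]|[x [y /dvdzP[z hz]]]] :=
  @global_solution t a c b `|det2 a c b|%N pos.
- by rewrite dvdzE.
- by apply: gram_rep_trans h; apply: IH => //; lia.
have [c0 d0] := pos; have [a0 _] := posdef2_swap pos.
apply: gram_rep_trans (gram3_gram2 a c z b x y); apply: gram3_diag => //.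
split=> //; rewrite /det3 -/(adjform a c b x y).
have <- : `|det2 a c b|%N%:Z = det2 a c b by lia.
by rewrite -hz; ring.
Qed.

(** * Eisenstein integers inside the field E *)

Fact omega_Qsqrtm3 : omega \in Qsqrtm3.
Proof.
apply/Qsqrtm3P; exists (1 / 2%:R), (1 / 2%:R).
by rewrite fmorph_div rmorph1 rmorph_nat /omega; field.
Qed.
Definition omegaE : Efield := EField omega_Qsqrtm3.

Lemma omegaE_sqr : omegaE * omegaE = omegaE - 1.
Proof. by apply: val_inj; rewrite /= omega_sqr. Qed.

Lemma bar_omegaE : bar omegaE = 1 - omegaE.
Proof.
apply: val_inj; rewrite /= /omega fmorph_div rmorphD rmorph1 rmorph_nat /=.
by rewrite conj_sqrtm3; field.
Qed.

Definition toE (x : eis) : Efield := (coord1 x)%:~R + (coordw x)%:~R * omegaE.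
Fact toE_zmod : zmod_morphism toE.
Proof. by move=> [a b] [c d]; rewrite /toE /= !rmorphB /=; ring. Qed.
Fact toE_monoid : monoid_morphism toE.
Proof.
split=> [|[a b] [c d]]; first by rewrite /toE /= mul0r addr0.
by rewrite /toE /=; ring: omegaE_sqr.
Qed.
HB.instance Definition _ := GRing.isZmodMorphism.Build eis Efield toE toE_zmod.
HB.instance Definition _ :=
  GRing.isMonoidMorphism.Build eis Efield toE toE_monoid.

Lemma toE_int (a : int) : toE (Eis a 0) = a%:~R.
Proof. by rewrite /toE /= mul0r addr0. Qed.

Lemma bar_toE x : bar (toE x) = toE (econj x).
Proof.
rewrite /toE rmorphD rmorphM /= !rmorph_int bar_omegaE; ring.
Qed.

Lemma val_toE x : \val (toE x) = (coord1 x)%:~R + (coordw x)%:~R * omega.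
Proof. by rewrite /toE rmorphD rmorphM !rmorph_int. Qed.

Lemma Oring_toEP x : reflect (exists e, x = toE e) (x \in Oring).
Proof.
rewrite inE; apply: (iffP (ZomegaP _)) => [[a [b e]]|[[a b] ->]].
  by exists (Eis a b); apply: val_inj; rewrite val_toE.
by exists a, b; rewrite val_toE.
Qed.

Lemma toE_Oring x : toE x \in Oring. Proof. by apply/Oring_toEP; exists x. Qed.

Lemma intE_eq0 (a : int) : (a%:~R == 0 :> Efield) = (a == 0).
Proof.
apply/eqP/eqP => [/(congr1 \val)|-> //].
by rewrite rmorph_int rmorph0 => /eqP; rewrite intr_eq0 => /eqP.
Qed.

(** An element of the kernel has norm mapped to 0, and Z embeds into E. *)
Lemma toE_inj : injective toE.
Proof.
move=> x y /eqP; rewrite -subr_eq0 -rmorphB /= => /eqP xy.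
apply/eqP; rewrite -subr_eq0; apply/eqP/enorm_eq0/eqP.
by rewrite -intE_eq0 -toE_int -mul_econj rmorphM /= xy mul0r.
Qed.

Lemma toE_real x : bar (toE x) = toE x -> toE x = (coord1 x)%:~R.
Proof.
rewrite bar_toE => /toE_inj; case: x => a b [] h1 h2.
have -> : b = 0 by lia.
by rewrite toE_int.
Qed.

Lemma val_int_gt0 (a : int) : (0 < \val (a%:~R : Efield)) = (0 < a).
Proof. by rewrite rmorph_int ltr0z. Qed.

(** * Lattices of rank 2 have a basis *)

Section Ospan.
Variables (V : vectType Efield).
Implicit Types (s : seq V) (v : V).

Lemma Ospan_gen s v : v \in s -> Ospan s v.
Proof.
move=> vs; have iv : (index v s < size s)%N by rewrite index_mem.
exists (fun i => (i == Ordinal iv)%:R).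
split=> [i|]; first by rewrite rpred_nat.
rewrite (bigD1 (Ordinal iv)) //= eqxx scale1r nth_index // big1 ?addr0 //.
by move=> i /negbTE ->; rewrite scale0r.
Qed.

Lemma Ospan_comb s a x y : a \in Oring -> Ospan s x -> Ospan s y ->
  Ospan s (a *: x + y).
Proof.
move=> Oa [c [Oc ->]] [d [Od ->]]; exists (fun i => a * c i + d i).
split=> [i|]; first by rewrite rpredD ?rpredM.
rewrite scaler_sumr -big_split /=; apply: eq_bigr => i _.
by rewrite scalerDl scalerA.
Qed.

Lemma Ospan0 s : Ospan s 0.
Proof.
exists (fun=> 0); split=> [i|]; first by rewrite rpred0.
by rewrite big1 // => i _; rewrite scale0r.
Qed.

Lemma Ospan_sub s s' v : (forall x, x \in s -> Ospan s' x) ->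
  Ospan s v -> Ospan s' v.
Proof.
move=> ss' [c [Oc ->]]; elim/big_rec: _ => [|i x _ hx]; first exact: Ospan0.
by apply: Ospan_comb => //; apply/ss'/mem_nth.
Qed.

Lemma Ospan_span s v : Ospan s v -> v \in <<s>>%VS.
Proof.
move=> [c [_ ->]]; apply: memv_suml => i _.
by rewrite memvZ // memv_span // mem_nth.
Qed.

End Ospan.

Section Lattice.
Variable L : hermitian_lattice.
Hypothesis posL : positive_lattice L.
Hypothesis rankL : lat_rank L = 2%N.
Local Notation V := (lat_space L).
Local Notation H := (@lat_form L).
Implicit Types x y v : V.

Lemma lat_formC x y : H x y = bar (H y x).
Proof. by rewrite hermC expr0 mul1r. Qed.

Lemma lat_form_toE x y : in_lat x -> in_lat y -> exists e, H x y = toE e.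
Proof. by move=> Lx Ly; apply/Oring_toEP/lat_integral. Qed.

Lemma lat_norm_int x : in_lat x -> exists a : int, H x x = a%:~R.
Proof.
move=> Lx; have [e He] := lat_form_toE Lx Lx.
by exists (coord1 e); rewrite He; apply: toE_real; rewrite -He -lat_formC.
Qed.

(** The determinant is kept as an element of E: it is then defined, with its
    transformation rule, before one knows that it is an integer. *)
Definition gdet x y := H x x * H y y - H x y * H y x.

Lemma gdetC x y : gdet x y = gdet y x.
Proof. by rewrite /gdet; ring. Qed.

(** Adding a multiple of y changes nothing, so only a contributes. *)
Lemma gdet_comb x y a b : gdet (a *: x + b *: y) y = a * bar a * gdet x y.
Proof.
rewrite /gdet !linearDl !linearDr !linearZl_LR !linearZr_LR /=; ring.
Qed.

Lemma free2E x y : free [:: x; y] = (x \notin <[y]>%VS) && (y != 0).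
Proof. by rewrite free_cons span_seq1 seq1_free. Qed.

(** Cauchy-Schwarz: w = c x - b y is a nonzero lattice vector, and its norm is
    c times the determinant. *)
Lemma gram_pair x y : in_lat x -> in_lat y -> free [:: x; y] ->
  exists a c b,
    [/\ posdef2 a c b, H x x = a%:~R, H y y = c%:~R & H x y = toE b].
Proof.
move=> Lx Ly; rewrite free2E => /andP[xy y0].
have [a Ha] := lat_norm_int Lx; have [c Hc] := lat_norm_int Ly.
have [b Hb] := lat_form_toE Lx Ly; exists a, c, b; split=> //.
have c0 : 0 < c by rewrite -val_int_gt0 -Hc; apply: posL.
split=> //; pose w := toE (- b) *: y + (c%:~R *: x + 0).
have Lw : in_lat w.
  by do 2?apply: Ospan_comb; rewrite ?toE_Oring ?rpred_int //; apply: Ospan0.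
have w0 : w != 0.
  apply: contraNneq xy => w0.
  have : c%:~R *: x \in <[y]>%VS.
    have -> : c%:~R *: x = toE b *: y + w.
      by rewrite /w rmorphN scaleNr addr0 addrA subrr add0r.
    by rewrite w0 addr0 memvZ ?memv_line.
  by rewrite rpredZeq intE_eq0 gt_eqF.
have Hw : H w w = (c * det2 a c b)%:~R.
  rewrite /w addr0 !linearDl !linearDr !linearZl_LR !linearZr_LR /=.
  rewrite (lat_formC y x) Ha Hb Hc !bar_toE rmorph_int.
  have := mul_econj b => /(congr1 toE); rewrite rmorphM /= toE_int => E.
  rewrite /det2 !(rmorphB, rmorphN, rmorphM) /=; ring: E.
by have := posL Lw w0; rewrite Hw val_int_gt0 pmulr_rgt0.
Qed.

Definition has_det x y (d : nat) :=
  [/\ in_lat x, in_lat y, free [:: x; y], (0 < d)%N & gdet x y = d%:R].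

Lemma has_detC x y d : has_det x y d -> has_det y x d.
Proof.
case=> Lx Ly f d0 e; split; rewrite 1?gdetC //.
by rewrite (@perm_free _ _ _ [:: x; y]) // (perm_catC [:: y] [:: x]).
Qed.

Lemma has_det_ex x y : in_lat x -> in_lat y -> free [:: x; y] ->
  exists d, has_det x y d.
Proof.
move=> Lx Ly f; have [a [c [b [[c0 d0] Ha Hc Hb]]]] := gram_pair Lx Ly f.
exists `|det2 a c b|%N; split=> //; first by lia.
rewrite -[RHS]/((`|det2 a c b|%N : int)%:~R) gez0_abs; last by lia.
have := mul_econj b => /(congr1 toE); rewrite rmorphM /= toE_int => E.
by rewrite /gdet (lat_formC y x) Ha Hc Hb bar_toE /det2 rmorphB rmorphM E.
Qed.

(** Cramer's rule makes d a integral; rounding it to a multiple of d replaces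
    a by a remainder of norm at most 1/3 and multiplies the determinant by this
    norm, which is nonzero unless a is integral. *)
Lemma coord_integral x y d v a b : has_det x y d -> in_lat v ->
  v = a *: x + b *: y ->
  a \in Oring \/ exists x' y' d', has_det x' y' d' /\ (d' < d)%N.
Proof.
move=> [Lx Ly f d0 dE] Lv vE.
have [e eE] : exists e, d%:R * a = toE e.
  apply/Oring_toEP; have -> : d%:R * a = H v x * H y y - H v y * H y x.
    by rewrite vE !linearDl !linearZl_LR -dE /gdet /=; ring.
  by rewrite rpredB ?rpredM // ?lat_integral.
have dpos : 0 < (d : int) by lia.
have [q hq] := eis_round e dpos; pose r := e - q * Eis d 0.
have dI : toE (Eis d 0) = d%:R by rewrite toE_int.
have dn0 : d%:R != 0 :> Efield.
  by rewrite -[d%:R]/((d : int)%:~R) intE_eq0; lia.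
have rE : toE r = d%:R * (a - toE q).
  by rewrite /r rmorphB rmorphM /= dI mulrBr eE mulrC [d%:R * _]mulrC.
have [r0|rn0] := eqVneq r 0.
  left; have /eqP : d%:R * (a - toE q) = 0 by rewrite -rE r0 rmorph0.
  by rewrite mulf_eq0 (negbTE dn0) subr_eq0 => /eqP ->; apply: toE_Oring.
right; pose v' := toE (- q) *: x + v.
have v'E : v' = (a - toE q) *: x + b *: y.
  by rewrite /v' vE addrA -scalerDl rmorphN [- _ + a]addrC.
have Lv' : in_lat v' by apply: Ospan_comb => //; apply: toE_Oring.
have a0' : a - toE q != 0.
  apply: contra_neq rn0 => a0; apply: toE_inj; by rewrite rE a0 mulr0 rmorph0.
have f' : free [:: v'; y].
  move: f; rewrite !free2E => /andP[xy ->]; rewrite andbT.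
  apply: contra xy; rewrite v'E rpredDr; last by rewrite memvZ ?memv_line.
  by rewrite rpredZeq (negPf a0').
have [d' hd'] := has_det_ex Lv' Ly f'; exists v', y, d'; split=> //.
have [_ _ _ _ d'E] := hd'; move: d'E; rewrite v'E gdet_comb dE => d'E.
have E : (d' : int) * d = enorm r.
  apply/eqP; rewrite -subr_eq0 -intE_eq0 rmorphB rmorphM /= -[d'%:~R]d'E.
  rewrite -[(enorm r)%:~R]toE_int -mul_econj rmorphM /= -bar_toE rE.
  rewrite rmorphM rmorph_nat.
  by apply/eqP; ring.
by move: hq; rewrite -/r -E expr2; nia.
Qed.

Lemma exists_free_pair : exists x y, [/\ in_lat x, in_lat y & free [:: x; y]].
Proof.
have [/hasP[y ys y0]|/hasPn no] :=
    boolP (has (fun y => y != 0) (lat_gens L)); last first.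
  have : (<<lat_gens L>> <= 0)%VS.
    by apply/span_subvP=> y /no; rewrite negbK => /eqP ->; rewrite mem0v.
  by move/dimvS; rewrite dimv0 -/(lat_rank L) rankL.
have [/hasP[x xs xy]|/hasPn no] :=
    boolP (has (fun x => x \notin <[y]>%VS) (lat_gens L)).
  by exists x, y; split; [exact: Ospan_gen|exact: Ospan_gen|rewrite free2E xy].
have : (<<lat_gens L>> <= <[y]>)%VS.
  by apply/span_subvP=> x /no; rewrite negbK.
by move/dimvS; rewrite dim_vline y0 -/(lat_rank L) rankL.
Qed.

Lemma coords_in_pair x y v :
  in_lat x -> in_lat y -> free [:: x; y] -> in_lat v ->
  exists a b, v = a *: x + b *: y.
Proof.
move=> Lx Ly f Lv.
have /eqP sE : <<[:: x; y]>>%VS == <<lat_gens L>>%VS.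
  rewrite eqEdim -/(lat_rank L) rankL (eqP f) andbT.
  by apply/span_subvP => z; rewrite !inE => /orP[]/eqP ->; apply: Ospan_span.
have := Ospan_span Lv; rewrite -sE span_cons span_seq1.
by move=> /memv_addP[_ /vlineP[a ->] [_ /vlineP[b ->] ->]]; exists a, b.
Qed.

(** Descent on the determinant of a free pair: it stops at a pair in which all
    lattice vectors have integral coordinates. *)
Lemma lat_basis2 : exists x y, [/\ in_lat x, in_lat y, free [:: x; y] &
  forall v, in_lat v -> Ospan [:: x; y] v].
Proof.
have [x [y [Lx Ly f]]] := exists_free_pair; have [d] := has_det_ex Lx Ly f.
elim/ltn_ind: d x y {Lx Ly f} => d IH x y hd.
have [Lx Ly f _ _] := hd.
have dich v : in_lat v -> Ospan [:: x; y] v \/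
    exists x' y' d', has_det x' y' d' /\ (d' < d)%N.
  move=> Lv; have [a [b vE]] := coords_in_pair Lx Ly f Lv.
  have [Oa|] := coord_integral hd Lv vE; last by right.
  have vE' : v = b *: y + a *: x by rewrite addrC.
  have [Ob|] := coord_integral (has_detC hd) Lv vE'; last by right.
  left; rewrite vE -[b *: y]addr0.
  apply: Ospan_comb => //; first by apply: Ospan_gen; rewrite inE eqxx.
  apply: Ospan_comb => //; last exact: Ospan0.
  by apply: Ospan_gen; rewrite !inE eqxx orbT.
(* Deciding on the finitely many generators is enough, and constructive. *)
have [all_s|[x' [y' [d' [hd' lt]]]]] :
    (forall v, v \in lat_gens L -> Ospan [:: x; y] v) \/
    exists x' y' d', has_det x' y' d' /\ (d' < d)%N.
- have : forall v, v \in lat_gens L -> Ospan [:: x; y] v \/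
    exists x' y' d', has_det x' y' d' /\ (d' < d)%N.
    by move=> v vs; apply/dich/Ospan_gen.
  elim: (lat_gens L) => [|u s IHs] hs; first by left.
  have [|hu] := hs u (mem_head _ _); last by right.
  have [v vs|hs'|] := IHs; [by apply: hs; rewrite inE vs orbT| |by right].
  by move=> hu; left=> v; rewrite inE => /orP[/eqP ->|/hs'].
- exists x, y; split=> // v; exact: Ospan_sub.
- exact: IH lt _ _ hd'.
Qed.

End Lattice.

(** * The diagonal lattices *)

Lemma diag_basis (a : seq int) :
  @is_lat_basis (diag_lattice a) (size a) [tuple 'e_i | i < size a].
Proof.
split; last by move=> v; split.
apply/freeP => k k0 i; move/rowP/(_ i): k0.
rewrite summxE mxE (bigD1 i) //= big1 ?addr0 => [|j /negbTE ji].
  by rewrite (nth_map i) ?size_enum_ord // nth_ord_enum !mxE !eqxx mulr1.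
by rewrite (nth_map i) ?size_enum_ord // nth_ord_enum !mxE eqxx eq_sym ji mulr0.
Qed.

Lemma gram_diag (a : seq int) :
  @gram (diag_lattice a) (size a) [tuple 'e_i | i < size a] = diag_gram a.
Proof. by apply/matrixP => i j; rewrite mxE !tnth_mktuple; apply: formee. Qed.

Lemma diag_gram3 (t : int) :
  diag_gram [:: 1; 1; t] = map_mx toE (gram3 1 1 t 0 0 0).
Proof.
apply/(@matrixP _ 3 3); case=> [] [|[|[|//]]] ? [] [|[|[|//]]] ?;
rewrite !mxE /= ?rmorph0 ?toE_int //.
Qed.

Lemma positive_diag (a : seq int) : all (fun x => 0 < x) a ->
  positive_lattice (diag_lattice a).
Proof.
move=> /allP a0.
suff main (v : 'rV_(size a)) : v != 0 -> 0 < \val (@diag_form a v v).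
  by move=> v _; apply: main.
move=> v0.
have -> : @diag_form a v v =
    \sum_(i < size a) (a`_i)%:~R * (v 0 i * bar (v 0 i)).
  rewrite /diag_form /form mul_mx_diag mxE.
  by apply: eq_bigr => i _; rewrite !mxE; ring.
rewrite rmorph_sum.
have [i vi] : exists i, v 0 i != 0.
  apply/existsP; apply: contraNT v0; rewrite negb_exists => /forallP h.
  by apply/eqP/rowP => i; rewrite mxE; apply/eqP; rewrite -[_ == _]negbK.
have ap (j : 'I_(size a)) : (0 : algC) < (a`_j)%:~R.
  by rewrite ltr0z a0 ?mem_nth.
have nn (j : 'I_(size a)) :
    (0 : algC) <= \val ((a`_j)%:~R * (v 0 j * bar (v 0 j))).
  by rewrite rmorphM rmorph_int /= mulr_ge0 ?mul_conjC_ge0 // ltW.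
rewrite (bigD1 i) //; apply: ltr_wpDr.
  by apply: sumr_ge0 => j _; apply: nn.
rewrite rmorphM rmorph_int /= mulr_gt0 // mul_conjC_gt0.
by apply: contraNneq vi => e; apply/eqP/val_inj.
Qed.

Lemma two_universal_diag (t : int) : 0 < t <= 2 ->
  two_universal (diag_lattice [:: 1; 1; t]).
Proof.
move=> t2; split; first by apply: positive_diag; rewrite /=; lia.
move=> l rl pl; have [x [y [Lx Ly f Lspan]]] := lat_basis2 pl rl.
have [a [c [b [p Ha Hc Hb]]]] := gram_pair pl Lx Ly f.
have [X GX] := binary_rep t2 p.
exists 3%N, 2%N, [tuple 'e_i | i < 3], [tuple x; y], (map_mx toE X); split.
- exact: (diag_basis [:: 1; 1; t]).
- split=> // v; split; first exact: Lspan.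
  by apply: Ospan_sub => z; rewrite !inE => /orP[]/eqP ->.
- by apply/mxOverP => i j; rewrite mxE toE_Oring.
rewrite (gram_diag [:: 1; 1; t]) diag_gram3.
have -> : map_mx bar (map_mx toE X)^T = map_mx toE (adjmx X).
  by apply/matrixP => i j; rewrite !mxE bar_toE.
rewrite -!map_mxM /= -GX.
apply/matrixP; case=> [] [|[|//]] ? [] [|[|//]] ?;
  rewrite !mxE !(tnth_nth x) /= ?toE_int //.
by rewrite lat_formC Hb bar_toE.
Qed.

Theorem theorem3 :
  two_universal (diag_lattice [:: 1; 1; 1]) /\
  two_universal (diag_lattice [:: 1; 1; 2]).
Proof. by split; apply: two_universal_diag. Qed.
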